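(* Let $((\mathfrak g,[\cdot,\cdot]_{\mathfrak g}),(V;\rho),T)$ be a Lie-Leibniz triple. If two infinitesimal deformations generated by $(\omega,\varrho,\mathcal T)$ and $(\omega',\varrho',\mathcal T')$ are equivalent, then $(\omega,\varrho,\mathcal T)$ and $(\omega',\varrho',\mathcal T')$ are in the same cohomology class in $\mathcal H^2_{\rm reg}(\mathfrak g,\rho,T)$.
   Context: A Lie-Leibniz triple $((\mathfrak g,[\cdot,\cdot]_{\mathfrak g}),(V;\rho),T)$ consists of a Lie algebra $\mathfrak g$ over a field $\mathbb K$, a representation $\rho:\mathfrak g\to\mathfrak{gl}(V)$, and a linear map $T:V\to\mathfrak g$ with $[Tu,Tv]_{\mathfrak g}=T(\rho(Tu)v)$ for all $u,v\in V$. A homomorphism from $((\mathfrak g',[\cdot,\cdot]_{\mathfrak g'}),(V';\rho'),T')$ to $((\mathfrak g,[\cdot,\cdot]_{\mathfrak g}),(V;\rho),T)$ is a Lie algebra homomorphism $\phi:\mathfrak g'\to\mathfrak g$ and a linear map $\varphi:V'\to V$ with $T\circ\varphi=\phi\circ T'$ and $\varphi(\rho'(x)u)=\rho(\phi(x))\varphi(u)$. Infinitesimal deformation: $\omega\in\mathrm{Hom}(\wedge^2\mathfrak g,\mathfrak g)$, $\varrho\in\mathrm{Hom}(\mathfrak g\otimes V,V)$, $\mathcal T\in\mathrm{Hom}(V,\mathfrak g)$ generate an infinitesimal deformation if, extending $\mathbb K[[t]]/(t^2)$-linearly, $[\cdot,\cdot]_{\mathfrak g}+t\omega$ is a Lie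 algebra structure on $\mathfrak g[[t]]/(t^2)$, $\rho+t\varrho$ is a representation of it on $V[[t]]/(t^2)$, and $T_t=T+t\mathcal T$ satisfies $[T_tu,T_tv]_t=T_t(\rho_t(T_tu)(v))$ for $u,v\in V$, where $[\cdot,\cdot]_t=[\cdot,\cdot]_{\mathfrak g}+t\omega$, $\rho_t=\rho+t\varrho$. Two infinitesimal deformations generated by $(\omega,\varrho,\mathcal T)$ and $(\omega',\varrho',\mathcal T')$ are equivalent if there exist $N\in\mathfrak{gl}(\mathfrak g)$, $S\in\mathfrak{gl}(V)$, $x\in\mathfrak g$ such that $(\mathrm{Id}_{\mathfrak g}+tN+t\,\mathrm{ad}_x,\ \mathrm{Id}_V+tS+t\rho(x))$ is a homomorphism from $((\mathfrak g[[t]]/(t^2),[\cdot,\cdot]_{\mathfrak g}+t\omega'),(V[[t]]/(t^2);\rho+t\varrho'),T+t\mathcal T')$ to $((\mathfrak g[[t]]/(t^2),[\cdot,\cdot]_{\mathfrak g}+t\omega),(V[[t]]/(t^2);\rho+t\varrho),T+t\mathcal T)$. $\mathcal H^2_{\rm reg}(\mathfrak g,\rho,T)$ is the second cohomology of the complex $\mathfrak C^0=0$, $\mathfrak C^n(\mathfrak g,\rho,T)=\mathrm{Hom}(\wedge^n\mathfrak g,\mathfrak g)\oplus\mathrm{Hom}(\wedge^{n-1}\mathfrak g\otimes V,V)\oplus\mathrm{Hom}(\otimes^{n-1}V,\mathfrak g)$ ($n\ge1$; for $n=1$ the last summand is $\mathfrak g$), with $\mathcal D(f,\theta)=(\delta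 f,\partial_T\theta+\Omega_Tf)$ for $f=(f_{\mathfrak g},f_V)$, where $\delta f=((\delta f)_{\mathfrak g},(\delta f)_V)$, $(\delta f)_{\mathfrak g}=\mathrm d_{CE}f_{\mathfrak g}$ is the Chevalley-Eilenberg coboundary with adjoint coefficients, $$\begin{aligned}(\delta f)_V(x_1,\dots,x_n,v)=&\sum_{1\le i<j\le n}(-1)^if_V(x_1,\dots,\hat x_i,\dots,x_{j-1},[x_i,x_j]_{\mathfrak g},x_{j+1},\dots,x_n,v)+(-1)^{n-1}\rho(f_{\mathfrak g}(x_1,\dots,x_n))v\\&+\sum_{i=1}^n(-1)^{i+1}\big(\rho(x_i)f_V(x_1,\dots,\hat x_i,\dots,x_n,v)-f_V(x_1,\dots,\hat x_i,\dots,x_n,\rho(x_i)v)\big),\end{aligned}$$ for $\theta\in\mathrm{Hom}(\otimes^kV,\mathfrak g)$, $k\ge0$, $$\begin{aligned}\partial_T\theta(u_1,\dots,u_{k+1})=&\sum_{i=1}^k(-1)^{i+1}[Tu_i,\theta(u_1,\dots,\hat u_i,\dots,u_{k+1})]_{\mathfrak g}+(-1)^{k+1}[\theta(u_1,\dots,u_k),Tu_{k+1}]_{\mathfrak g}\\&+(-1)^kT(\rho(\theta(u_1,\dots,u_k))u_{k+1})+\sum_{1\le i<j\le k+1}(-1)^i\theta(u_1,\dots,\hat u_i,\dots,u_{j-1},\rho(Tu_i)u_j,u_{j+1},\dots,u_{k+1}),\end{aligned}$$ and $\Omega_T(f_{\mathfrak g},f_V)(v_1,\dots,v_n)=(-1)^n\big(f_{\mathfrak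 g}(Tv_1,\dots,Tv_n)-Tf_V(Tv_1,\dots,Tv_{n-1},v_n)\big)$. *)

(* Defs.v *)
From HB Require Import structures.
From mathcomp Require Import all_boot all_order all_algebra.

Set Implicit Arguments.
Unset Strict Implicit.
Unset Printing Implicit Defensive.

Import GRing.Theory.
Local Open Scope ring_scope.

(* [Trunc2 a b] is a + t b, an element of M[[t]]/(t^2).  For M = K a ring this
   is K[[t]]/(t^2); for a K-module M it is a K[[t]]/(t^2)-module. *)
Record trunc2 (M : Type) := Trunc2 { tc0 : M; tc1 : M }.

Section TruncRepr.
Variable M : Type.
Definition trunc2_pair (u : trunc2 M) : M * M := (tc0 u, tc1 u).
Definition trunc2_of_pair (p : M * M) : trunc2 M := Trunc2 p.1 p.2.
Lemma trunc2_pairK : cancel trunc2_pair trunc2_of_pair. Proof. by case. Qed.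
End TruncRepr.

HB.instance Definition _ (M : eqType) :=
  Equality.copy (trunc2 M) (can_type (@trunc2_pairK M)).
HB.instance Definition _ (M : choiceType) :=
  Choice.copy (trunc2 M) (can_type (@trunc2_pairK M)).

Section TruncZmod.
Variable M : zmodType.
Implicit Types u v w : trunc2 M.
Definition trunc2_zero : trunc2 M := Trunc2 0 0.
Definition trunc2_opp u : trunc2 M := Trunc2 (- tc0 u) (- tc1 u).
Definition trunc2_add u v : trunc2 M :=
  Trunc2 (tc0 u + tc0 v) (tc1 u + tc1 v).
Lemma trunc2_addA : associative trunc2_add.
Proof. by move=> u v w; rewrite /trunc2_add /= !addrA. Qed.
Lemma trunc2_addC : commutative trunc2_add.
Proof.
by move=> u v; rewrite /trunc2_add (addrC (tc0 u)) (addrC (tc1 u)).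
Qed.
Lemma trunc2_add0 : left_id trunc2_zero trunc2_add.
Proof. by case=> a b; rewrite /trunc2_add /= !add0r. Qed.
Lemma trunc2_addN : left_inverse trunc2_zero trunc2_opp trunc2_add.
Proof. by case=> a b; rewrite /trunc2_add /= !addNr. Qed.
HB.instance Definition _ := GRing.isZmodule.Build (trunc2 M)
  trunc2_addA trunc2_addC trunc2_add0 trunc2_addN.
End TruncZmod.

Section TruncRing.
Variable R : comNzRingType.
Implicit Types a b : trunc2 R.
Definition trunc2_one : trunc2 R := Trunc2 1 0.
Definition trunc2_mul a b : trunc2 R :=
  Trunc2 (tc0 a * tc0 b) (tc0 a * tc1 b + tc1 a * tc0 b).
Lemma trunc2_mulA : associative trunc2_mul.
Proof.
move=> a b c; rewrite /trunc2_mul /=; congr Trunc2; first by rewrite mulrA.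
by rewrite mulrDr mulrDl !mulrA addrA.
Qed.
Lemma trunc2_mulC : commutative trunc2_mul.
Proof.
move=> a b; rewrite /trunc2_mul; congr Trunc2; first by rewrite mulrC.
by rewrite addrC mulrC [tc0 a * _]mulrC.
Qed.
Lemma trunc2_mul1 : left_id trunc2_one trunc2_mul.
Proof. by case=> a b; rewrite /trunc2_mul /= !mul1r mul0r addr0. Qed.
Lemma trunc2_mulDl : left_distributive trunc2_mul +%R.
Proof.
move=> a b c; congr Trunc2; rewrite /= !mulrDl //.
by rewrite addrACA.
Qed.
Lemma trunc2_one_neq0 : trunc2_one != 0.
Proof. by apply/eqP => /(congr1 (@tc0 R)) /eqP; rewrite oner_eq0. Qed.
HB.instance Definition _ := GRing.Zmodule_isComNzRing.Build (trunc2 R)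
  trunc2_mulA trunc2_mulC trunc2_mul1 trunc2_mulDl trunc2_one_neq0.
End TruncRing.

Section TruncLmod.
Variables (R : comNzRingType) (M : lmodType R).
Implicit Types (a b : trunc2 R) (u v : trunc2 M).
Definition trunc2_scale a u : trunc2 M :=
  Trunc2 (tc0 a *: tc0 u) (tc0 a *: tc1 u + tc1 a *: tc0 u).
Lemma trunc2_scaleA a b u :
  trunc2_scale a (trunc2_scale b u) = trunc2_scale (a * b) u.
Proof.
congr Trunc2; rewrite /= ?scalerDr ?scalerDl ?scalerA //.
by rewrite addrA.
Qed.
Lemma trunc2_scale1 : left_id (1 : trunc2 R) trunc2_scale.
Proof. by case=> x y; rewrite /trunc2_scale /= !scale1r scale0r addr0. Qed.
Lemma trunc2_scaleDr : right_distributive trunc2_scale +%R.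
Proof.
by move=> a u v; congr Trunc2; rewrite /= !scalerDr // addrACA.
Qed.
Lemma trunc2_scaleDl u : {morph trunc2_scale^~ u : a b / a + b}.
Proof.
by move=> a b; congr Trunc2; rewrite /= !scalerDl // addrACA.
Qed.
HB.instance Definition _ := GRing.Zmodule_isLmodule.Build (trunc2 R) (trunc2 M)
  trunc2_scaleA trunc2_scale1 trunc2_scaleDr trunc2_scaleDl.
End TruncLmod.

(* The K[[t]]/(t^2)-linear extension of f0 + t f1, for f0, f1 linear. *)
Definition text1 (M N : zmodType) (f0 f1 : M -> N) (u : trunc2 M) : trunc2 N :=
  Trunc2 (f0 (tc0 u)) (f0 (tc1 u) + f1 (tc0 u)).

(* The K[[t]]/(t^2)-bilinear extension of f0 + t f1, for f0, f1 bilinear. *)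
Definition text2 (M N P : zmodType) (f0 f1 : M -> N -> P)
    (u : trunc2 M) (v : trunc2 N) : trunc2 P :=
  Trunc2 (f0 (tc0 u) (tc0 v))
    (f0 (tc0 u) (tc1 v) + f0 (tc1 u) (tc0 v) + f1 (tc0 u) (tc0 v)).

Section LieLeibniz.
Variable R : comNzRingType.

Definition bilin (M N P : lmodType R) (f : M -> N -> P) : Prop :=
  (forall u, linear (f u)) /\ (forall v, linear (f^~ v)).

Definition lie_bracket (g : lmodType R) (br : g -> g -> g) : Prop :=
  [/\ bilin br,
      forall x, br x x = 0 &
      forall x y z, br x (br y z) + br y (br z x) + br z (br x y) = 0].

Definition lie_representation (g V : lmodType R)
    (br : g -> g -> g) (rho : g -> V -> V) : Prop :=
  bilin rho /\
  (forall x y v, rho (br x y) v = rho x (rho y v) - rho y (rho x v)).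

(* The underlying maps ([.,.], rho, T); also used for the shape of the
   deforming maps (omega, varrho, calT). *)
Record lie_leibniz_maps (g V : lmodType R) := LieLeibnizMaps {
  lbr : g -> g -> g;
  lact : g -> V -> V;
  lop : V -> g
}.

Definition lie_leibniz_triple (g V : lmodType R) (A : lie_leibniz_maps g V) :=
  [/\ lie_bracket (lbr A),
      lie_representation (lbr A) (lact A),
      linear (lop A) &
      forall u v, lbr A (lop A u) (lop A v) = lop A (lact A (lop A u) v)].

Definition lie_leibniz_hom (g' V' g V : lmodType R)
    (A' : lie_leibniz_maps g' V') (A : lie_leibniz_maps g V)
    (phi : g' -> g) (psi : V' -> V) : Prop :=
  [/\ linear phi,
      forall x y, phi (lbr A' x y) = lbr A (phi x) (phi y),
      linear psi,
      forall u, lop A (psi u) = phi (lop A' u) &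
      forall x u, psi (lact A' x u) = lact A (phi x) (psi u)].

End LieLeibniz.

Section Deformation.
Variables (K : fieldType) (g V : lmodType K).
Variable A : lie_leibniz_maps g V.
Implicit Type B : lie_leibniz_maps g V.

Definition deform B : lie_leibniz_maps (trunc2 g) (trunc2 V) :=
  LieLeibnizMaps (text2 (lbr A) (lbr B)) (text2 (lact A) (lact B))
                 (text1 (lop A) (lop B)).

Definition infinitesimal_deformation B : Prop :=
  [/\ [/\ bilin (lbr B), forall x, lbr B x x = 0,
          bilin (lact B) & linear (lop B)],
      lie_bracket (lbr (deform B)),
      lie_representation (lbr (deform B)) (lact (deform B)) &
      forall u v : V,
        let Tt (w : V) := lop (deform B) (Trunc2 w 0) in
        lbr (deform B) (Tt u) (Tt v) =
        lop (deform B) (lact (deform B) (Tt u) (Trunc2 v 0))].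

Definition equivalent_deformations B B' : Prop :=
  exists (N : g -> g) (S : V -> V) (x : g),
    [/\ linear N, linear S &
        lie_leibniz_hom (deform B') (deform B)
          (text1 id (fun y => N y + lbr A x y))
          (text1 id (fun u => S u + lact A x u))].

End Deformation.

Section FinFamily.
Variable X : Type.

(* (x_1, ..., \hat x_i, ..., x_{n+1}) *)
Definition fdel n (i : 'I_n.+1) (xs : {ffun 'I_n.+1 -> X}) : {ffun 'I_n -> X} :=
  [ffun k => xs (lift i k)].

(* (x_1, ..., x_{i-1}, y, x_{i+1}, ..., x_n) *)
Definition fset_at n (i : 'I_n) (y : X) (xs : {ffun 'I_n -> X}) :
    {ffun 'I_n -> X} :=
  [ffun k => if k == i then y else xs k].

(* (y, x_1, ..., x_n) *)
Definition fcons n (y : X) (xs : {ffun 'I_n -> X}) : {ffun 'I_n.+1 -> X} :=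
  [ffun k => if unlift ord0 k is Some l then xs l else y].

End FinFamily.

Definition fmap_ffun (X Y : Type) n (f : X -> Y) (xs : {ffun 'I_n -> X}) :
  {ffun 'I_n -> Y} := [ffun k => f (xs k)].

Section Cochains.
Variables (K : fieldType) (g V : lmodType K).

Definition multilinear (M N : lmodType K) n (f : {ffun 'I_n -> M} -> N) :=
  forall (xs : {ffun 'I_n -> M}) (i : 'I_n), linear (fun y => f (fset_at i y xs)).

Definition alternating (M N : lmodType K) n (f : {ffun 'I_n -> M} -> N) :=
  forall (xs : {ffun 'I_n -> M}) (i j : 'I_n), i != j -> xs i = xs j -> f xs = 0.

(* [cochain n] holds the cochains of degree n.+1.  Degree 0, where the complex
   is zero, is left out: it affects cohomology in degree 1 only. *)
Record cochain (n : nat) := Cochain {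
  cog : {ffun 'I_n.+1 -> g} -> g;
  coV : {ffun 'I_n -> g} -> V -> V;
  coT : {ffun 'I_n -> V} -> g
}.

Definition is_cochain n (c : cochain n) : Prop :=
  [/\ multilinear (cog c) /\ alternating (cog c),
      forall v, multilinear (fun xs => coV c xs v) /\
                alternating (fun xs => coV c xs v),
      forall xs, linear (coV c xs) &
      multilinear (coT c)].

Definition cochain_eq n (c d : cochain n) : Prop :=
  [/\ forall xs, cog c xs = cog d xs,
      forall xs v, coV c xs v = coV d xs v &
      forall us, coT c us = coT d us].

Definition cochain_zero n : cochain n :=
  Cochain (fun=> 0) (fun _ _ => 0) (fun=> 0).

Definition cochain_sub n (c d : cochain n) : cochain n :=
  Cochain (fun xs => cog c xs - cog d xs)
          (fun xs v => coV c xs v - coV d xs v)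
          (fun us => coT c us - coT d us).

Variable A : lie_leibniz_maps g V.
Local Notation "[[ x , y ]]" := (lbr A x y) (at level 0).
Local Notation rho := (lact A).
Local Notation T := (lop A).

(* In all the formulas below indices start from 0, so that the sign (-1)^i
   of an index i counted from 1 becomes (-1)^{i+1}. *)

(* Chevalley-Eilenberg coboundary with adjoint coefficients.  In the second sum
   the first removed index is i : 'I_n.+1 with i < j; then [lift j i] is the
   same number as an element of 'I_n.+2. *)
Definition dCE n (f : {ffun 'I_n.+1 -> g} -> g) (xs : {ffun 'I_n.+2 -> g}) : g :=
  \sum_(i < n.+2) (-1) ^+ i *: [[xs i, f (fdel i xs)]]
  + \sum_(j < n.+2) \sum_(i < n.+1 | (i < j)%N)
      (-1) ^+ (i + j) *:
        f (fcons [[xs (lift j i), xs j]] (fdel i (fdel j xs))).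

Definition deltaV n (fg : {ffun 'I_n.+1 -> g} -> g)
    (fV : {ffun 'I_n -> g} -> V -> V) (xs : {ffun 'I_n.+1 -> g}) (v : V) : V :=
  \sum_(i < n.+1) \sum_(j < n.+1 | (i < j)%N)
      (-1) ^+ i.+1 *: fV (fdel i (fset_at j [[xs i, xs j]] xs)) v
  + (-1) ^+ n *: rho (fg xs) v
  + \sum_(i < n.+1)
      (-1) ^+ i *: (rho (xs i) (fV (fdel i xs) v) - fV (fdel i xs) (rho (xs i) v)).

Definition partialT k (theta : {ffun 'I_k -> V} -> g)
    (us : {ffun 'I_k.+1 -> V}) : g :=
  \sum_(i < k.+1 | (i < k)%N) (-1) ^+ i *: [[T (us i), theta (fdel i us)]]
  + (-1) ^+ k.+1 *: [[theta (fdel ord_max us), T (us ord_max)]]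
  + (-1) ^+ k *: T (rho (theta (fdel ord_max us)) (us ord_max))
  + \sum_(i < k.+1) \sum_(j < k.+1 | (i < j)%N)
      (-1) ^+ i.+1 *: theta (fdel i (fset_at j (rho (T (us i)) (us j)) us)).

Definition OmegaT n (fg : {ffun 'I_n.+1 -> g} -> g)
    (fV : {ffun 'I_n -> g} -> V -> V) (vs : {ffun 'I_n.+1 -> V}) : g :=
  (-1) ^+ n.+1 *:
    (fg (fmap_ffun T vs) -
     T (fV (fmap_ffun T (fdel ord_max vs)) (vs ord_max))).

Definition cobD n (c : cochain n) : cochain n.+1 :=
  Cochain (dCE (cog c)) (deltaV (cog c) (coV c))
          (fun us => partialT (coT c) us + OmegaT (cog c) (coV c) us).

Definition cocycle n (c : cochain n) : Prop :=
  is_cochain c /\ cochain_eq (cobD c) (cochain_zero n.+1).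

Definition coboundary n (c : cochain n.+1) : Prop :=
  exists b : cochain n, is_cochain b /\ cochain_eq c (cobD b).

(* Both cochains are cocycles and they define the same class in the cohomology
   of degree n.+2. *)
Definition same_cohomology_class n (c d : cochain n.+1) : Prop :=
  [/\ cocycle c, cocycle d & coboundary (cochain_sub c d)].

(* (omega, varrho, calT) as a cochain of degree 2. *)
Definition cochain2 (B : lie_leibniz_maps g V) : cochain 1 :=
  Cochain (fun xs => lbr B (xs ord0) (xs ord_max))
          (fun xs v => lact B (xs ord0) v)
          (fun us => lop B (us ord0)).

End Cochains.

(* Main.v *)
Require Import Defs.
From HB Require Import structures.
From mathcomp Require Import all_boot all_order all_algebra.

(* The coefficient of t in the axioms of the deformed triple is the cocycle
   condition.  The coefficient of t in the homomorphism conditions says that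
   (omega - omega', varrho - varrho', calT - calT') is the coboundary of the
   degree 1 cochain (- N, - S, - x): the inner parts ad_x and rho(x) drop out of
   the first two components since they are derivations, and their commutator
   with T is the value of partial_T on the element - x of g. *)

Set Implicit Arguments.
Unset Strict Implicit.
Unset Printing Implicit Defensive.

Import GRing.Theory.
Local Open Scope ring_scope.

(** * Linear and bilinear maps given as bare functions *)

Section LinearProp.
Variables (R : comNzRingType) (M N : lmodType R) (f : M -> N).
Hypothesis f_lin : linear f.

Lemma linear_prop0 : f 0 = 0.
Proof.
have /(congr1 (fun y => y - f 0)) := f_lin 1 0 0.
by rewrite scaler0 addr0 scale1r addrK subrr.
Qed.

Lemma linear_propD u v : f (u + v) = f u + f v.
Proof. by rewrite -[u in LHS]scale1r f_lin scale1r. Qed.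

Lemma linear_propN u : f (- u) = - f u.
Proof. by rewrite -[- u]addr0 -scaleN1r f_lin scaleN1r linear_prop0 addr0. Qed.

Lemma linear_opp : linear (fun u => - f u).
Proof. by move=> a u v; rewrite f_lin opprD scalerN. Qed.

End LinearProp.

Section BilinearProp.
Variables (R : comNzRingType) (M N P : lmodType R) (f : M -> N -> P).
Hypothesis f_bilin : bilin f.

Lemma bilin0r u : f u 0 = 0.
Proof. exact: linear_prop0 (f_bilin.1 u). Qed.

Lemma bilin0l v : f 0 v = 0.
Proof. exact: linear_prop0 (f_bilin.2 v). Qed.

Lemma bilinDr u v w : f u (v + w) = f u v + f u w.
Proof. exact: linear_propD (f_bilin.1 u) v w. Qed.

Lemma bilinDl u v w : f (u + v) w = f u w + f v w.
Proof. exact: linear_propD (f_bilin.2 w) u v. Qed.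

Lemma bilinNr u v : f u (- v) = - f u v.
Proof. exact: linear_propN (f_bilin.1 u) v. Qed.

Lemma bilinNl u v : f (- u) v = - f u v.
Proof. exact: linear_propN (f_bilin.2 v) u. Qed.

End BilinearProp.

(** Polarization: in the expansion of [f (x + y) (x + y) = 0] the diagonal terms vanish. Nothing is
    divided by 2, so the characteristic is arbitrary. *)
Lemma bilin_skew (R : comNzRingType) (M N : lmodType R) (f : M -> M -> N) :
  bilin f -> (forall x, f x x = 0) -> forall x y, f x y = - f y x.
Proof.
move=> fb falt x y; apply/eqP; rewrite -addr_eq0.
have := falt (x + y).
by rewrite (bilinDl fb) !(bilinDr fb) !falt add0r addr0 => ->.
Qed.

Section Ordinals.
Variable n : nat.

Lemma lift_lift0_0 (i : 'I_n.+1) : lift (lift ord0 i) ord0 = ord0.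
Proof. exact: val_inj. Qed.

Lemma lift_lift0_lift0 (i : 'I_n.+1) (j : 'I_n) :
  lift (lift ord0 i) (lift ord0 j) = lift ord0 (lift i j).
Proof. by apply: val_inj; rewrite /= /bump /= !add1n ltnS addnS. Qed.

Lemma ord_max_lift : ord_max = lift ord0 ord_max :> 'I_n.+2.
Proof. exact: val_inj. Qed.

Lemma ord_max1 : ord_max = ord0 :> 'I_1.
Proof. exact: val_inj. Qed.

End Ordinals.

(** Drives indices towards iterated [lift ord0] of [ord0], so that entries reached through different
    deletions become syntactically comparable. *)
Definition lift_normE := (lift_lift0_0, lift_lift0_lift0, ord_max_lift, ord_max1).

(** * The coboundary operators on cochains of degrees 1 and 2 *)

Section LowDegree.
Variables (K : fieldType) (g V : lmodType K) (A : lie_leibniz_maps g V).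

(** Here and below the arguments are written through [ys ord0] and [ys ord_max] to match the
    components of [cochain2] and of the bounding cochain. *)
Lemma dCE_deg1 (f : g -> g) (xs : {ffun 'I_2 -> g}) :
  dCE A (fun ys : {ffun 'I_1 -> g} => f (ys ord0)) xs =
  lbr A (xs ord0) (f (xs ord_max)) - lbr A (xs ord_max) (f (xs ord0))
  - f (lbr A (xs ord0) (xs ord_max)).
Proof.
rewrite /dCE.
(* The condition [i < j] moves into the summand, so that [big_ord_recl] can unfold the sum; the
   excluded pairs contribute 0. *)
under [X in _ + X]eq_bigr => j _ do rewrite big_mkcond.
rewrite !(big_ord_recl, big_ord0) /= !ffunE !unlift_none /=.
rewrite /bump /= !expr0 !expr1 !scale1r !scaleN1r !addr0 ?add0r.
by rewrite !lift_normE.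
Qed.

Lemma dCE_deg2 (f : g -> g -> g) (xs : {ffun 'I_3 -> g}) :
  let x := xs ord0 in let y := xs (lift ord0 ord0) in let z := xs ord_max in
  dCE A (fun ys : {ffun 'I_2 -> g} => f (ys ord0) (ys ord_max)) xs =
  lbr A x (f y z) - lbr A y (f x z) + lbr A z (f x y)
  - f (lbr A x y) z + f (lbr A x z) y - f (lbr A y z) x.
Proof.
rewrite /dCE /=.
under [X in _ + X]eq_bigr => j _ do rewrite big_mkcond.
rewrite !(big_ord_recl, big_ord0) /= !ffunE !unlift_none /= !lift_normE.
rewrite !liftK /bump /= !ffunE !lift_normE.
rewrite !(addn0, addn1, add0n, add1n) !exprS !expr0 !mulN1r !opprK.
by rewrite !scale1r !scaleN1r !addr0 ?add0r !addrA.
Qed.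

Lemma deltaV_deg1 (fg : g -> g) (fV : V -> V) (xs : {ffun 'I_1 -> g}) v :
  let x := xs ord0 in
  deltaV A (fun ys : {ffun 'I_1 -> g} => fg (ys ord0)) (fun=> fV) xs v =
  lact A (fg x) v + (lact A x (fV v) - fV (lact A x v)).
Proof.
rewrite /deltaV /=.
under [X in X + _ + _]eq_bigr => j _ do rewrite big_mkcond.
rewrite !(big_ord_recl, big_ord0) /= !expr0 !scale1r.
by rewrite !addr0 add0r.
Qed.

Lemma deltaV_deg2 (fg : g -> g -> g) (fV : g -> V -> V)
    (xs : {ffun 'I_2 -> g}) v :
  let x := xs ord0 in let y := xs ord_max in
  deltaV A (fun ys : {ffun 'I_2 -> g} => fg (ys ord0) (ys ord_max))
    (fun ys : {ffun 'I_1 -> g} => fV (ys ord0)) xs v =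
  - fV (lbr A x y) v - lact A (fg x y) v
  + ((lact A x (fV y v) - fV y (lact A x v))
     - (lact A y (fV x v) - fV x (lact A y v))).
Proof.
rewrite /deltaV /=.
under [X in X + _ + _]eq_bigr => j _ do rewrite big_mkcond.
rewrite !(big_ord_recl, big_ord0) /= !ffunE /= !lift_normE.
rewrite /bump /= ?addn0 !expr1 !expr0 !scale1r !scaleN1r.
by rewrite !addr0 !add0r ?addr0.
Qed.

(** For [k = 0] the map [theta] is a single element of [g] and both sums are empty; only the terms
    in the last argument survive. *)
Lemma partialT_deg1 (theta : {ffun 'I_0 -> V} -> g) (us : {ffun 'I_1 -> V}) :
  let u := us ord0 in let x := theta (fdel ord0 us) in
  partialT A theta us =
  - lbr A x (lop A u) + lop A (lact A x u).
Proof.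
rewrite /partialT /= big_mkcond.
under [X in _ + _ + X]eq_bigr => j _ do rewrite big_mkcond.
rewrite !(big_ord_recl, big_ord0) /= !lift_normE.
by rewrite !addr0 add0r expr1 expr0 scale1r scaleN1r.
Qed.

Lemma partialT_deg2 (theta : V -> g) (us : {ffun 'I_2 -> V}) :
  let u := us ord0 in let v := us ord_max in
  partialT A (fun ws : {ffun 'I_1 -> V} => theta (ws ord0)) us =
  lbr A (lop A u) (theta v) + lbr A (theta u) (lop A v)
  - lop A (lact A (theta u) v) - theta (lact A (lop A u) v).
Proof.
rewrite /partialT /= big_mkcond.
under [X in _ + _ + X]eq_bigr => j _ do rewrite big_mkcond.
rewrite !(big_ord_recl, big_ord0) /= !ffunE /= !lift_normE.
rewrite !exprS !expr0 mulr1 mulN1r opprK !scale1r !scaleN1r.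
by rewrite !addr0 ?add0r.
Qed.

Lemma OmegaT_deg1 (fg : g -> g) (fV : V -> V) (vs : {ffun 'I_1 -> V}) :
  let v := vs ord0 in
  OmegaT A (fun ys : {ffun 'I_1 -> g} => fg (ys ord0)) (fun=> fV) vs =
  - (fg (lop A v) - lop A (fV v)).
Proof. by rewrite /OmegaT /= ffunE lift_normE expr1 scaleN1r. Qed.

Lemma OmegaT_deg2 (fg : g -> g -> g) (fV : g -> V -> V)
    (vs : {ffun 'I_2 -> V}) :
  let u := vs ord0 in let v := vs ord_max in
  OmegaT A (fun ys : {ffun 'I_2 -> g} => fg (ys ord0) (ys ord_max))
    (fun ys : {ffun 'I_1 -> g} => fV (ys ord0)) vs =
  fg (lop A u) (lop A v) - lop A (fV (lop A u) v).
Proof.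
rewrite /OmegaT /= !ffunE exprS expr1 mulN1r opprK scale1r.
(* The index of [u] inside [fV] still has another form: deleting the last argument leaves the first,
   of value 0. *)
by rewrite !lift_normE; congr (_ - lop A (fV (lop A (vs _)) _)); apply: val_inj.
Qed.

End LowDegree.

(** * The cocycle given by an infinitesimal deformation *)

Section Deformations.
Variables (K : fieldType) (g V : lmodType K) (A B : lie_leibniz_maps g V).
Hypothesis A_triple : lie_leibniz_triple A.
Hypothesis B_def : infinitesimal_deformation A B.

Let brA : bilin (lbr A). Proof. by case: A_triple => -[]. Qed.
Let actA : bilin (lact A). Proof. by case: A_triple => _ []. Qed.
Let opA : linear (lop A). Proof. by case: A_triple. Qed.
Let brB : bilin (lbr B). Proof. by case: B_def => -[]. Qed.
Let actB : bilin (lact B). Proof. by case: B_def => -[]. Qed.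
Let opB : linear (lop B). Proof. by case: B_def => -[]. Qed.
(** The axioms are evaluated at elements [Trunc2 x 0]; these rules remove the terms fed by the zero
    coefficient of [t]. *)
Let bilE := (bilin0r brA, bilin0l brA, bilin0r actA, bilin0l actA,
             bilin0r brB, bilin0l brB, bilin0r actB, bilin0l actB,
             linear_prop0 opA, linear_prop0 opB, add0r, addr0).

Lemma deformation_jacobi x y z :
  (lbr A x (lbr B y z) + lbr B x (lbr A y z))
  + (lbr A y (lbr B z x) + lbr B y (lbr A z x))
  + (lbr A z (lbr B x y) + lbr B z (lbr A x y)) = 0.
Proof.
case: B_def => _ [_ _ jac] _ _.
have /(congr1 (@tc1 _)) := jac (Trunc2 x 0) (Trunc2 y 0) (Trunc2 z 0).
by rewrite /= !bilE.
Qed.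

Lemma deformation_action x y v :
  lact A (lbr B x y) v + lact B (lbr A x y) v =
  (lact A x (lact B y v) + lact B x (lact A y v))
  - (lact A y (lact B x v) + lact B y (lact A x v)).
Proof.
case: B_def => _ _ [_ rep] _.
have /(congr1 (@tc1 _)) := rep (Trunc2 x 0) (Trunc2 y 0) (Trunc2 v 0).
by rewrite /= !bilE.
Qed.

Lemma deformation_embedding u v :
  lbr A (lop A u) (lop B v) + lbr A (lop B u) (lop A v)
    + lbr B (lop A u) (lop A v) =
  lop A (lact A (lop B u) v + lact B (lop A u) v) + lop B (lact A (lop A u) v).
Proof.
case: B_def => _ _ _ emb.
have /(congr1 (@tc1 _)) := emb u v.
by rewrite /= !bilE.
Qed.

Lemma cochain2_is_cochain : is_cochain (cochain2 B).
Proof.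
case: B_def => -[_ altB _ _] _ _ _.
split=> /= [|v|xs|us i]; last 2 first.
- exact: actB.1.
- by rewrite (ord1 i) => a u v; rewrite !ffunE; exact: opB.
- split=> [xs i a u v|xs i j].
    (* [unliftP] separates the second slot, [lift ord0 k], from the first, [ord0]. *)
    rewrite !ffunE !ord_max_lift; case: (unliftP ord0 i) => [k|] ->; last first.
      by rewrite /= !lift_normE; exact: brB.2.
    by rewrite (ord1 k) !lift_normE; exact: brB.1.
  have brm p q : xs p = xs q -> lbr B (xs p) (xs q) = 0 by move=> ->.
  case: (unliftP ord0 i) => [k|] ->; case: (unliftP ord0 j) => [l|] -> //.
  + by rewrite (ord1 k) (ord1 l) eqxx.
  + by rewrite (ord1 k) !lift_normE => _ e; exact: brm (esym e).
  + by rewrite (ord1 l) !lift_normE => _; exact: brm.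
- split=> [xs i a u w|xs i j]; last by rewrite (ord1 i) (ord1 j) eqxx.
  by rewrite (ord1 i) !ffunE; exact: actB.2.
Qed.

Lemma deformation_cocycle : cocycle A (cochain2 B).
Proof.
split; first exact: cochain2_is_cochain.
have altB : forall x, lbr B x x = 0 by case: B_def => -[].
have skB := bilin_skew brB altB.
split=> /= [xs|xs v|us].
(* The right-hand 0 is replaced by the cyclic sum; skew-symmetry of both brackets turns it into the
   alternating sum of [dCE]. *)
- rewrite (dCE_deg2 A (lbr B)) -[RHS](deformation_jacobi (xs ord0)
    (xs (lift ord0 ord0)) (xs ord_max)).
  set x := xs _; set y := xs _; set z := xs _.
  rewrite (skB z x) (bilinNr brA y) (skB x (lbr A y z)) (skB z (lbr A x y)).
  have skA : lbr A z x = - lbr A x z.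
    by apply: bilin_skew => //; case: A_triple => -[].
  rewrite skA (bilinNr brB) (skB y (lbr A x z)) opprK.
  by rewrite -!addrA; congr (_ + _); rewrite !addrA (ACl (5*1*4*2*3)).
- rewrite (deltaV_deg2 A (lbr B) (lact B)).
  set x := xs _; set y := xs _.
  have /eqP := deformation_action x y v; rewrite -subr_eq0 => /eqP e.
  (* [deltaV] is minus the [t]-coefficient of the representation identity, whence [oppr0]; for the
     operator component below the signs agree. *)
  rewrite -[RHS]oppr0 -e !(opprD, opprK) !addrA.
  by rewrite (ACl (2*1*3*6*5*4)).
- rewrite (partialT_deg2 A (lop B)) (OmegaT_deg2 A (lbr B) (lact B)).
  set u := us _; set v := us _.
  have /eqP := deformation_embedding u v; rewrite -subr_eq0 => /eqP e.
  rewrite -[RHS]e (linear_propD opA) !opprD !addrA.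
  by rewrite (ACl (1*2*5*3*6*4)).
Qed.

End Deformations.

(* The shape of the coefficient of t in phi (b y z) = b (phi y) (phi z): the
   terms p and q come from the inner derivation and cancel. *)
Lemma inner_derivation_cancel (M : zmodType) (b b' s q a1 p a2 : M) :
  b' + (s + q) = a1 + p + (a2 + (q - p)) + b -> b - b' = s - a1 - a2.
Proof.
rewrite !addrA [RHS](ACl (1*3*6*(2*5)*4)) /= subrr addr0 => /addIr e.
apply/eqP; rewrite -addrA -opprD subr_eq addrAC eq_sym subr_eq.
by rewrite [s + _]addrC e (ACl (3*(1*2))).
Qed.

(** * Equivalent deformations differ by a coboundary *)

Section Equivalence.
Variables (K : fieldType) (g V : lmodType K) (A B B' : lie_leibniz_maps g V).
Hypothesis A_triple : lie_leibniz_triple A.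

Lemma equivalent_deformations_coboundary :
  equivalent_deformations A B B' ->
  coboundary A (cochain_sub (cochain2 B) (cochain2 B')).
Proof.
case: (A_triple) => -[brA altA jacA] [actA repA] opA _.
have skA := bilin_skew brA altA.
pose bilE := (bilin0r brA, bilin0l brA, bilin0r actA, bilin0l actA,
             linear_prop0 opA, add0r, addr0).
case=> N [S [x [Nlin Slin [_ hom_br _ hom_op hom_act]]]].
have br_eq y z : lbr B y z - lbr B' y z =
    N (lbr A y z) - lbr A y (N z) + lbr A z (N y).
  have /(congr1 (@tc1 _)) := hom_br (Trunc2 y 0) (Trunc2 z 0).
  rewrite /= !bilE (bilinDl brA) (bilinDr brA).
  (* The Jacobi identity as the derivation rule for [lbr A x]: it gives the term [q - p] of
     [inner_derivation_cancel]. For the action, [repA] does the same. *)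
  have -> : lbr A (lbr A x y) z = lbr A x (lbr A y z) - lbr A y (lbr A x z).
    apply/eqP; rewrite eq_sym subr_eq -subr_eq0 -(jacA x y z).
    by rewrite (skA z (lbr A x y)) (skA z x) (bilinNr brA) opprD addrA addrAC.
  by move/inner_derivation_cancel => ->; rewrite (skA z).
have act_eq y u : lact B y u - lact B' y u =
    S (lact A y u) - lact A y (S u) - lact A (N y) u.
  have /(congr1 (@tc1 _)) := hom_act (Trunc2 y 0) (Trunc2 u 0).
  rewrite /= !bilE (bilinDl actA) (bilinDr actA) repA.
  exact: inner_derivation_cancel.
(* Here the inner parts remain, since [T] need not intertwine [rho(x)] with [ad_x]. *)
have op_eq u : lop B u - lop B' u =
    N (lop A u) - lop A (S u) + lbr A x (lop A u) - lop A (lact A x u).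
  have /(congr1 (@tc1 _)) := hom_op (Trunc2 u 0).
  rewrite /= !bilE (linear_propD opA).
  move=> e; apply/eqP; rewrite subr_eq (ACl (1*3*5*2*4)) /= -addrA -opprD.
  by rewrite eq_sym subr_eq [X in _ == X]addrC e addrC.
(* The signs are forced: the coboundary of [(N, S, x)] is the negative of the three differences just
   computed. *)
exists (Cochain (fun xs : {ffun 'I_1 -> g} => - N (xs ord0))
  (fun=> fun v => - S v) (fun=> - x)); split; last split=> /=.
(* Families in the second and third components are indexed by ['I_0], so multilinearity and
   alternation in them are vacuous. *)
- split=> [|v|xs|xs i]; [split | split | |] => /=; try by move=> ? [].
  + by move=> xs i a u v; rewrite (ord1 i) !ffunE; exact: linear_opp Nlin a u v.
  + by move=> xs i j; rewrite (ord1 i) (ord1 j) eqxx.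
  + exact: linear_opp Slin.
  + by case: i.
- move=> xs; rewrite (dCE_deg1 A (fun y => - N y)) br_eq !(bilinNr brA) !opprK.
  by rewrite (ACl (2*3*1)).
- move=> xs v; rewrite (deltaV_deg1 A (fun y => - N y) (fun v => - S v)).
  rewrite act_eq (bilinNr actA) (bilinNl actA) !opprK.
  by rewrite (ACl (3*(2*1))).
- move=> us; rewrite partialT_deg1
    (OmegaT_deg1 A (fun y => - N y) (fun v => - S v)).
  rewrite op_eq (bilinNl brA) (bilinNl actA) !(linear_propN opA) opprB !opprK.
  by rewrite addrA [RHS](ACl (4*3*1*2)).
Qed.

End Equivalence.

Theorem theorem5p10 (K : fieldType) (g V : lmodType K)
    (A : lie_leibniz_maps g V) (hA : lie_leibniz_triple A)
    (omega omega' : g -> g -> g) (varrho varrho' : g -> V -> V)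
    (calT calT' : V -> g) :
  infinitesimal_deformation A (LieLeibnizMaps omega varrho calT) ->
  infinitesimal_deformation A (LieLeibnizMaps omega' varrho' calT') ->
  equivalent_deformations A (LieLeibnizMaps omega varrho calT)
                            (LieLeibnizMaps omega' varrho' calT') ->
  same_cohomology_class A (cochain2 (LieLeibnizMaps omega varrho calT))
                          (cochain2 (LieLeibnizMaps omega' varrho' calT')).
Proof.
move=> hB hB' heq; split; [exact: deformation_cocycle..|].
exact: equivalent_deformations_coboundary.
Qed.
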